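(* Let $\mathbb{F}$ be a field with $\operatorname{char}\mathbb{F}\neq 2$. The only $3$-dimensional non-abelian pseudo-Riemannian Lie algebra $\mathfrak{g}$ over $\mathbb{F}$ with non-trivial center is a Heisenberg Lie algebra. Assume that $x,y,z$ is a standard basis of $\mathfrak{g}$ such that $[x,y]=z$. Then the product and the scalar product $(\ ,\ )$ can be given as follows. 1) $(x,z)=1$, $(y,y)\neq 0$, and otherwise zero. 2) $xx=-\frac{1}{(y,y)}\,y$, $xy=z$, and otherwise zero. Furthermore, $\mathfrak{g}$ cannot be a Riemann-Lie algebra.
   Context: A pseudo-Riemannian Lie algebra over a field $\mathbb{F}$ with $\operatorname{char}\mathbb{F}\neq 2$ is a Lie algebra $\mathfrak{g}$ with a non-degenerate symmetric bilinear form $(\ ,\ )$ (also called the scalar product) such that the bilinear product $(u,v)\mapsto uv$ on $\mathfrak{g}$ defined by $2(uv,w)=([u,v],w)+([w,u],v)+([w,v],u)$ satisfies $[uv,w]+[u,wv]=0$ for all $u,v,w\in\mathfrak{g}$. The defining formula for the product is equivalent to the two conditions $uv-vu=[u,v]$ and $(uv,w)+(v,uw)=0$ for all $u,v,w\in\mathfrak{g}$. It is called a Riemann-Lie algebra if $(\ ,\ )$ is positive definite. The center is $\{a\in\mathfrak{g}: ax=xa \text{ for all } x\in\mathfrak{g}\}$, that is, the center of the Lie algebra. The Heisenberg Lie algebra is the $3$-dimensional Lie algebra with a standard basis $x,y,z$ satisfying $[x,y]=z$, $[x,z]=[y,z]=0$. ''Otherwise zero'' refers to the remaining pairs of basis vectors,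 up to the symmetry of the form in 1). *)

(* Defs.v *)
From mathcomp Require Import all_boot all_order all_algebra.
From mathcomp Require Export sesquilinear.

Set Implicit Arguments.
Unset Strict Implicit.
Unset Printing Implicit Defensive.

Import GRing.Theory.
Local Open Scope ring_scope.

(* MathComp has no Lie algebras: a Lie algebra is a finite-dimensional vector  *)
(* space g together with a bilinear bracket satisfying the following predicate *)
Definition lie_bracket (F : fieldType) (g : vectType F)
    (br : {bilinear g -> g -> g}) : Prop :=
  (forall u, br u u = 0) /\
  (forall u v w, br u (br v w) + br v (br w u) + br w (br u v) = 0).

Definition abelian_lie (F : fieldType) (g : vectType F)
    (br : {bilinear g -> g -> g}) : Prop :=
  forall u v, br u v = 0.

(* When sp is non-degenerate and the characteristic is not 2, the formula      *)
(* determines mul completely, and mul is then bilinear                         *)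
Definition koszul_product (F : fieldType) (g : vectType F)
    (br : {bilinear g -> g -> g}) (sp : {symmetric g})
    (mul : g -> g -> g) : Prop :=
  forall u v w,
    2 * sp (mul u v) w = sp (br u v) w + sp (br w u) v + sp (br w v) u.

Record pseudo_riemannian_lie (F : fieldType) (g : vectType F)
    (br : {bilinear g -> g -> g}) (sp : {symmetric g})
    (mul : g -> g -> g) : Prop := PseudoRiemannianLie {
  prl_lie : lie_bracket br;
  prl_nondegenerate : nondegenerate sp;
  prl_koszul : koszul_product br sp mul;
  prl_compat : forall u v w, br (mul u v) w + br u (mul w v) = 0
}.

(* Positive definiteness requires an ordered base field *)
Definition riemann_lie (R : realFieldType) (g : vectType R)
    (br : {bilinear g -> g -> g}) (sp : {symmetric g})
    (mul : g -> g -> g) : Prop :=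
  pseudo_riemannian_lie br sp mul /\ (forall u, u != 0 -> 0 < sp u u).

(* By the Koszul formula uv - vu = [u, v], so this is the centre of the Lie     *)
(* algebra                                                                    *)
Definition in_center (F : fieldType) (g : vectType F)
    (mul : g -> g -> g) (a : g) : Prop :=
  forall x, mul a x = mul x a.

Definition nontrivial_center (F : fieldType) (g : vectType F)
    (mul : g -> g -> g) : Prop :=
  exists2 a : g, a != 0 & in_center mul a.

Definition standard_basis (F : fieldType) (g : vectType F)
    (br : {bilinear g -> g -> g}) (x y z : g) : Prop :=
  [/\ basis_of fullv [:: x; y; z], br x y = z, br x z = 0 & br y z = 0].

Definition heisenberg (F : fieldType) (g : vectType F)
    (br : {bilinear g -> g -> g}) : Prop :=
  exists x y z : g, standard_basis br x y z.

Definition scalar_product_table (F : fieldType) (g : vectType F)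
    (sp : {symmetric g}) (x y z : g) : Prop :=
  [/\ sp x z = 1, sp y y != 0 &
      [/\ sp x x = 0, sp x y = 0, sp y z = 0 & sp z z = 0]].

Definition product_table (F : fieldType) (g : vectType F)
    (sp : {symmetric g}) (mul : g -> g -> g) (x y z : g) : Prop :=
  [/\ mul x x = - (sp y y)^-1 *: y, mul x y = z & mul x z = 0] /\
  [/\ mul y x = 0, mul y y = 0 & mul y z = 0] /\
  [/\ mul z x = 0, mul z y = 0 & mul z z = 0].

(* Main.v *)
Require Import Defs.
From HB Require Import structures.
From mathcomp Require Import all_boot all_order all_algebra.
From mathcomp Require Import ring.

(* Let [a] be central and nonzero.  Compatibility makes [a u] central, hence a
   multiple [l_u a], and [(a u, u) = 0] then forces [([u, v], a) = 0].  In
   dimension 3 the derived algebra is a line [<w>].  If [w] were not central we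
   could pick [t] with [[t, w] = w]; writing [[u, w] = f(u) w], [[t, u] = h(u) w],
   Koszul's formula gives [(tt, u) = - h(u) (w, t)] and [(wt, u) = - h(u) (w, w)],
   while compatibility reads [f(tt) + h(wt) = 0]; evaluating [(w, tt)] and
   [(w, wt)] yields [(w, t) = (w, w) = 0], so [w] is in the radical, a
   contradiction.  Hence [w] spans the centre, is isotropic, and a basis can be
   adjusted to the stated normal form. *)

Set Implicit Arguments.
Unset Strict Implicit.
Unset Printing Implicit Defensive.

Import GRing.Theory.
Local Open Scope ring_scope.

(** * Coordinates and bases in dimension three *)

Lemma basis3_coord (F : fieldType) (g : vectType F) (x y z : g) :
  basis_of fullv [:: x; y; z] ->
  exists f1 f2 f3 : {scalar g},
    [/\ forall u, u = f1 u *: x + f2 u *: y + f3 u *: z,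
        [/\ f1 x = 1, f2 x = 0 & f3 x = 0],
        [/\ f1 y = 0, f2 y = 1 & f3 y = 0] &
        [/\ f1 z = 0, f2 z = 0 & f3 z = 1]].
Proof.
pose X := [tuple x; y; z]; move=> bX.
pose i0 : 'I_3 := ord0; pose i1 : 'I_3 := lift ord0 ord0.
pose i2 : 'I_3 := lift ord0 (lift ord0 ord0).
have fX : free X := basis_free bX.
exists (coord X i0), (coord X i1), (coord X i2).
have ->: x = X`_i0 by []. have ->: y = X`_i1 by []. have ->: z = X`_i2 by [].
split=> [u|||]; try by split; exact: (coord_free _ _ fX).
rewrite {1}(coord_basis (X := X) bX (memvf u)).
by rewrite !big_ord_recl big_ord0 addr0 addrA.
Qed.

Lemma basis3_of_free (F : fieldType) (g : vectType F) (x y z : g) :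
  \dim {:g} = 3%N ->
  (forall a b c, a *: x + b *: y + c *: z = 0 -> [/\ a = 0, b = 0 & c = 0]) ->
  basis_of fullv [:: x; y; z].
Proof.
move=> dg fxyz; rewrite basisEfree subvf dg leqnn !andbT.
apply/(@freeP _ _ _ [tuple x; y; z]) => k.
rewrite !big_ord_recl big_ord0 addr0 addrA => /fxyz[k0 k1 k2].
by case=> [[|[|[|//]]] lt_i]; [move: k0 | move: k1 | move: k2];
  move=> <-; congr k; apply: val_inj.
Qed.

(** * Symmetric bilinear forms *)

Section SymmetricForm.
Context (F : fieldType) (g : vectType F) (sp : {symmetric g}).
Implicit Types u v w : g.

Lemma symC u v : sp u v = sp v u.
Proof. by rewrite hermC expr0 mul1r. Qed.

Lemma sym0l w : sp 0 w = 0. Proof. exact: linear0l. Qed.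

Lemma symNl w : {morph sp^~ w : u / - u}. Proof. exact: linearNl. Qed.

Lemma symBl w : {morph sp^~ w : u v / u - v}. Proof. exact: linearBl. Qed.

Lemma symZl a u w : sp (a *: u) w = a * sp u w. Proof. exact: linearZl_LR. Qed.

Lemma sym0r w : sp w 0 = 0. Proof. exact: linear0r. Qed.

Lemma symDr w : {morph sp w : u v / u + v}. Proof. exact: linearDr. Qed.

Lemma symBr w : {morph sp w : u v / u - v}. Proof. exact: linearBr. Qed.

Lemma symZr a u w : sp u (a *: w) = a * sp u w. Proof. exact: linearZr_LR. Qed.

Lemma nondegenerate_inj u v :
  nondegenerate sp -> (forall w, sp u w = sp v w) -> u = v.
Proof.
move=> /eqP nd e; apply/eqP; rewrite -subr_eq0 -memv0 -nd.
by apply/mem_orthovP => w _; rewrite symBl e subrr.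
Qed.

End SymmetricForm.

(** * Brackets in the presence of a central vector *)

Lemma lie_anti (F : fieldType) (g : vectType F) (br : {bilinear g -> g -> g})
    (u v : g) :
  lie_bracket br -> br u v = - br v u.
Proof.
case=> alt _; apply/eqP; rewrite -addr_eq0; apply/eqP.
by rewrite -[RHS](alt (u + v)) linearDl !linearDr !alt add0r addr0.
Qed.

(** Bracketing a relation [p x + q y + r a = 0] with [x] isolates [q [x, y]], and bracketing it with
    [y] isolates [p [x, y]]. *)
Lemma noncommuting_central_basis (F : fieldType) (g : vectType F)
    (br : {bilinear g -> g -> g}) (x y a : g) :
  \dim {:g} = 3%N -> lie_bracket br -> (forall u, br a u = 0) -> a != 0 ->
  br x y != 0 -> basis_of fullv [:: x; y; a].
Proof.
move=> dg lie ca a0 xy0; have [alt _] := lie.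
apply: basis3_of_free => // p q r e.
have ca' u : br u a = 0 by rewrite (lie_anti _ _ lie) ca oppr0.
have := congr1 (fun u => br u y) e; have := congr1 (br x) e.
rewrite !linearDl !linearDr !linear0l !linear0r.
rewrite !linearZl_LR !linearZr_LR !alt ca ca' /= !scaler0 !addr0 add0r.
move=> /eqP; rewrite scaler_eq0 (negPf xy0) orbF => /eqP q0.
move=> /eqP; rewrite scaler_eq0 (negPf xy0) orbF => /eqP p0.
move: e; rewrite p0 q0 !scale0r !add0r => /eqP.
by rewrite scaler_eq0 (negPf a0) orbF => /eqP.
Qed.

Lemma two_neq0 (F : fieldType) : 2%N \notin [pchar F] -> (2 : F) != 0.
Proof. by rewrite inE. Qed.

(** The Koszul expressions for [(au, w)] and [(ua, w)] differ by [2 ([a, u], w)]. *)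
Lemma in_center_bracket (F : fieldType) (g : vectType F)
    (br : {bilinear g -> g -> g}) (sp : {symmetric g}) (mul : g -> g -> g)
    (a : g) :
  2%N \notin [pchar F] -> pseudo_riemannian_lie br sp mul ->
  in_center mul a -> forall u, br a u = 0.
Proof.
move=> /two_neq0 F2 [lie nd kz _] ca u; apply: (nondegenerate_inj nd) => w.
rewrite sym0l; apply: (mulfI F2); rewrite mulr0.
have := kz a u w; rewrite (ca u) kz (lie_anti u a lie) symNl => /eqP.
rewrite -subr_eq0 => /eqP e; rewrite -[RHS]oppr0 -e; ring.
Qed.

Lemma central_orthogonal_bracket (F : fieldType) (g : vectType F)
    (br : {bilinear g -> g -> g}) (sp : {symmetric g}) (mul : g -> g -> g)
    (a : g) :
  2%N \notin [pchar F] -> \dim {:g} = 3%N -> pseudo_riemannian_lie br sp mul ->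
  (forall u, br a u = 0) -> a != 0 -> forall u v, sp (br u v) a = 0.
Proof.
move=> /two_neq0 F2 dg [lie nd kz cp] ca a0 u v.
have [alt _] := lie.
have ca' t : br t a = 0 by rewrite (lie_anti _ _ lie) ca oppr0.
have [->|uv0] := eqVneq (br u v) 0; first by rewrite sym0l.
have [f [h [k [dec _ _ _]]]] :=
  basis3_coord (noncommuting_central_basis dg lie ca a0 uv0).
(* Compatibility makes [at] central; its brackets with [v] and [u] then kill its coordinates along
   [u] and [v]. *)
have av t : exists l, mul a t = l *: a.
  have ct w : br (mul a t) w = 0 by have := cp a t w; rewrite ca addr0.
  exists (k (mul a t)); have := ct u; have := ct v.
  rewrite {1 2}(dec (mul a t)) !linearDl !linearZl_LR /= !alt !ca !scaler0.
  rewrite !addr0 add0r (lie_anti v u lie) scalerN => /eqP.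
  rewrite scaler_eq0 (negPf uv0) orbF => /eqP f0 /eqP.
  rewrite oppr_eq0 scaler_eq0 (negPf uv0) orbF => /eqP h0.
  by rewrite {1}(dec (mul a t)) f0 h0 !scale0r !add0r.
have K s t : 2 * sp (mul a t) s = sp (br s t) a.
  by rewrite kz ca ca' !sym0l !add0r.
(* Taking [s = t = v] in [K] gives [l (a, v) = 0]. If [l = 0], then [av = 0] and [K u v] concludes;
   if [(a, v) = 0], then [K v u] does, since [au] is a multiple of [a]. *)
have [l el] := av v; have [m em] := av u.
have := K v v; rewrite alt sym0l => /eqP; rewrite mulf_eq0 (negPf F2) /=.
rewrite el symZl mulf_eq0 => /orP[/eqP l0|/eqP av0].
  by rewrite -K el l0 scale0r sym0l mulr0.
by rewrite (lie_anti u v lie) symNl -K em symZl av0 !mulr0 oppr0.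
Qed.

Lemma bracket_fixed_eq0 (F : fieldType) (g : vectType F)
    (br : {bilinear g -> g -> g}) (sp : {symmetric g}) (mul : g -> g -> g)
    (a t w : g) :
  2%N \notin [pchar F] -> \dim {:g} = 3%N -> pseudo_riemannian_lie br sp mul ->
  (forall u, br a u = 0) -> a != 0 -> br t w = w -> w = 0.
Proof.
move=> F2 dg prl ca a0 tw.
have wa : sp w a = 0.
  by rewrite -tw (central_orthogonal_bracket F2 dg prl ca a0).
have {}F2 := two_neq0 F2; have [lie nd kz cp] := prl; have [alt _] := lie.
have ca' s : br s a = 0 by rewrite (lie_anti _ _ lie) ca oppr0.
have [//|w0] := eqVneq w 0.
have tw0 : br t w != 0 by rewrite tw.
(* The basis is [t, w, a], so [f] and [h] are the coordinates along [t] and [w]. *)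
have [f [h [k [dec [ft ht _] [fw hw _] _]]]] :=
  basis3_coord (noncommuting_central_basis dg lie ca a0 tw0).
have wt : br w t = - w by rewrite (lie_anti _ _ lie) tw.
have brw u : br u w = f u *: w.
  by rewrite {1}(dec u) !linearDl !linearZl_LR /= tw alt ca !scaler0 !addr0.
have brt u : br t u = h u *: w.
  rewrite {1}(dec u) !linearDr !linearZr_LR /= tw alt ca' !scaler0.
  by rewrite addr0 add0r.
have spw u : sp w u = f u * sp w t + h u * sp w w.
  by rewrite {1}(dec u) !symDr !symZr wa mulr0 addr0.
set q := sp w t in spw; set p := sp w w in spw.
have stt u : sp (mul t t) u = - h u * q.
  apply: (mulfI F2); rewrite kz alt (lie_anti u t lie) brt sym0l symNl.
  rewrite symZl -/q; ring.
have swt u : sp (mul w t) u = - h u * p.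
  apply: (mulfI F2); rewrite kz wt brw (lie_anti u t lie) brt !symNl.
  rewrite !symZl -/q -/p spw; ring.
have fh : f (mul t t) + h (mul w t) = 0.
  apply/eqP; have /eqP := cp t t w.
  by rewrite brw brt -scalerDl scaler_eq0 (negPf w0) orbF.
(* The functionals [(tt, _)] and [(wt, _)] are both multiples of [h], so the vectors are
   proportional. *)
have prop : q *: mul w t = p *: mul t t.
  apply: (nondegenerate_inj nd) => u.
  by rewrite !symZl stt swt; ring.
have ef := congr1 f prop; have eh := congr1 h prop.
rewrite !linearZ /= in ef eh.
(* Pairing with [w], where [h] equals 1, gives [-q] and [-p]. The proportionality then trades
   [q f(wt)] for [p f(tt)] and [p h(tt)] for [q h(wt)], so both right-hand sides acquire the
   vanishing factor of [fh]. *)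
have ett := spw (mul t t); rewrite symC stt hw in ett.
have ewt := spw (mul w t); rewrite symC swt hw in ewt.
have p0 : p = 0.
  have -> : p = - (f (mul w t) * q + h (mul w t) * p) by rewrite -ewt; ring.
  rewrite [f _ * q]mulrC ef.
  by rewrite [h _ * p]mulrC -mulrDr fh mulr0 oppr0.
have q0 : q = 0.
  have -> : q = - (f (mul t t) * q + h (mul t t) * p) by rewrite -ett; ring.
  rewrite [h _ * p]mulrC -eh.
  by rewrite [f _ * q]mulrC -mulrDr fh mulr0 oppr0.
by apply: (nondegenerate_inj nd) => u; rewrite spw p0 q0 !mulr0 addr0 sym0l.
Qed.

(** Put [w = [x, y]]. In the basis [x, y, a], both [[x, w]] and [[y, w]] are multiples of [w], with
    coefficients [h w] and [- f w]. A nonzero coefficient could be rescaled to give [[t, w] = w],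
    which [bracket_fixed_eq0] excludes; only the [a]-coordinate of [w] survives. *)
Lemma bracket_central_line (F : fieldType) (g : vectType F)
    (br : {bilinear g -> g -> g}) (sp : {symmetric g}) (mul : g -> g -> g)
    (a x y : g) :
  2%N \notin [pchar F] -> \dim {:g} = 3%N -> pseudo_riemannian_lie br sp mul ->
  (forall u, br a u = 0) -> a != 0 -> exists c, br x y = c *: a.
Proof.
move=> F2 dg prl ca a0; have [lie _ _ _] := prl; have [alt _] := lie.
have [->|w0] := eqVneq (br x y) 0; first by exists 0; rewrite scale0r.
have [f [h [k [dec _ _ _]]]] :=
  basis3_coord (noncommuting_central_basis dg lie ca a0 w0).
have key t : br t (br x y) != br x y.
  by apply: contraNneq w0 => /(bracket_fixed_eq0 F2 dg prl ca a0) ->.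
set w := br x y in key w0 *.
have ca' s : br s a = 0 by rewrite (lie_anti _ _ lie) ca oppr0.
have xw : br x w = h w *: w.
  rewrite {1}(dec w) !linearDr !linearZr_LR /= alt ca' !scaler0.
  by rewrite addr0 add0r.
have yw : br y w = - (f w *: w).
  rewrite {1}(dec w) !linearDr !linearZr_LR /= alt ca' !scaler0 !addr0.
  by rewrite (lie_anti y x lie) scalerN.
have h0 : h w = 0.
  apply/eqP/negPn/negP => hw0; have /eqP[] := key ((h w)^-1 *: x).
  by rewrite linearZl_LR /= xw scalerA mulVf // scale1r.
have f0 : f w = 0.
  apply/eqP/negPn/negP => fw0; have /eqP[] := key (- (f w)^-1 *: y).
  by rewrite linearZl_LR /= yw scalerN scaleNr opprK scalerA mulVf // scale1r.
by exists (k w); rewrite {1}(dec w) h0 f0 !scale0r !add0r.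
Qed.

(** * The product determined by the scalar product *)

(** By non-degeneracy, each entry of the table is checked by comparing Koszul's formula with the
    pairings against [x], [y] and [z]. *)
Lemma product_table_of_koszul (F : fieldType) (g : vectType F)
    (br : {bilinear g -> g -> g}) (sp : {symmetric g}) (mul : g -> g -> g)
    (x y z : g) :
  2%N \notin [pchar F] -> pseudo_riemannian_lie br sp mul ->
  standard_basis br x y z -> scalar_product_table sp x y z ->
  product_table sp mul x y z.
Proof.
move=> /two_neq0 F2 [lie nd kz _] [bas xy xz yz] [sxz syy [sxx sxy syz szz]].
have [alt _] := lie.
have yx : br y x = - z by rewrite (lie_anti _ _ lie) xy.
have zx : br z x = 0 by rewrite (lie_anti _ _ lie) xz oppr0.
have zy : br z y = 0 by rewrite (lie_anti _ _ lie) yz oppr0.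
have szx : sp z x = 1 by rewrite symC.
have syx : sp y x = 0 by rewrite symC.
have szy : sp z y = 0 by rewrite symC.
have [f [h [k [dec _ _ _]]]] := basis3_coord bas.
have ext u v : sp u x = sp v x -> sp u y = sp v y -> sp u z = sp v z -> u = v.
  move=> ex ey ez; apply: (nondegenerate_inj nd) => w.
  by rewrite (dec w) !symDr !symZr ex ey ez.
have sE := (sxx, sxy, sxz, syx, syz, szx, szy, szz).
have brE := (alt, xy, xz, yz, yx, zx, zy).
have mE u v m : 2 * sp m x = sp (br u v) x + sp (br x u) v + sp (br x v) u ->
    2 * sp m y = sp (br u v) y + sp (br y u) v + sp (br y v) u ->
    2 * sp m z = sp (br u v) z + sp (br z u) v + sp (br z v) u ->
    mul u v = m.
  by move=> ex ey ez; apply: ext; apply: (mulfI F2); rewrite kz.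
by do ![split]; apply: mE; rewrite ?symZl ?brE ?symNl ?sym0l ?sE;
  try ring; field.
Qed.

(** * Construction of an adapted standard basis *)

(** Witnesses are found constructively: by bilinearity it suffices to search the finitely many pairs
    of basis vectors, a decidable question. *)
Lemma nonabelian_noncommuting (F : fieldType) (g : vectType F)
    (br : {bilinear g -> g -> g}) :
  ~ abelian_lie br -> exists x y, br x y != 0.
Proof.
pose e := vbasis {:g}.
have [/existsP[i /existsP[j nz]] _|/existsPn H []] :=
  boolP [exists i : 'I_(\dim {:g}), exists j : 'I_(\dim {:g}),
           br e`_i e`_j != 0].
  by exists e`_i, e`_j.
move=> u v; rewrite (coord_vbasis (memvf u)) (coord_vbasis (memvf v)).
rewrite linear_sumr big1 // => j _; rewrite linear_sumlz big1 // => i _.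
have /existsPn/(_ j)/negPn/eqP := H i.
by rewrite linearZl_LR linearZr_LR /= => ->; rewrite !scaler0.
Qed.

Lemma central_standard_basis (F : fieldType) (g : vectType F)
    (br : {bilinear g -> g -> g}) (sp : {symmetric g}) (mul : g -> g -> g) :
  2%N \notin [pchar F] -> \dim {:g} = 3%N -> pseudo_riemannian_lie br sp mul ->
  ~ abelian_lie br -> nontrivial_center mul ->
  exists x y z : g, standard_basis br x y z /\ scalar_product_table sp x y z.
Proof.
move=> F2 dg prl /nonabelian_noncommuting[x0 [y0 z0]] [a a0 /in_center_bracket].
move=> /(_ _ _ F2 prl) ca; have [lie nd _ _] := prl; have [alt _] := lie.
have [c ec] := bracket_central_line x0 y0 F2 dg prl ca a0.
set z := br x0 y0 in z0 ec.
have cz u : br z u = 0 by rewrite ec linearZl_LR /= ca scaler0.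
have cz' u : br u z = 0 by rewrite (lie_anti _ _ lie) cz oppr0.
(* Since [z] is itself central, orthogonality of brackets to central vectors applies to [z] against
   itself. *)
have szz : sp z z = 0 := central_orthogonal_bracket F2 dg prl cz z0 x0 y0.
have [u _ zu] : exists2 u, u \in fullv & sp z u != 0.
  by apply/mem_orthovPn; rewrite (eqP nd) memv0.
have [x1 zx1] : exists x1, sp z x1 = 1.
  by exists ((sp z u)^-1 *: u); rewrite symZr mulVf.
(* If [x1] commuted with both [x0] and [y0], it would be a multiple of the isotropic [z], against
   [(z, x1) = 1]. *)
have [v x1v] : exists v, br x1 v != 0.
  have [f [h [k [dec _ _ _]]]] :=
    basis3_coord (noncommuting_central_basis dg lie cz z0 z0).
  have x1y0 : br x1 y0 = f x1 *: z.
    rewrite {1}(dec x1) !linearDl !linearZl_LR /= alt cz !scaler0.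
    by rewrite !addr0.
  have x1x0 : br x1 x0 = - (h x1 *: z).
    rewrite {1}(dec x1) !linearDl !linearZl_LR /= alt cz !scaler0.
    by rewrite addr0 add0r (lie_anti y0 x0 lie) scalerN.
  have [f0|f0] := eqVneq (f x1) 0; last first.
    by exists y0; rewrite x1y0 scaler_eq0 negb_or f0.
  exists x0; rewrite x1x0 oppr_eq0 scaler_eq0 negb_or z0 andbT.
  apply: contraTneq (oner_neq0 F) => h0.
  by rewrite -zx1 (dec x1) f0 h0 !scale0r !add0r symZr szz mulr0 eqxx.
have [k ek] := bracket_central_line x1 v F2 dg prl cz z0.
have k0 : k != 0 by apply: contraNneq x1v => k0; rewrite ek k0 scale0r.
(* Removing [(z, v) x1] from [v] makes it orthogonal to [z] without changing its bracket with [x1];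
   the factor [k^-1] normalizes that bracket. *)
have [y1 zy1 x1y1] : exists2 y1, sp z y1 = 0 & br x1 y1 = z.
  exists (k^-1 *: (v - sp z v *: x1)).
    by rewrite symZr symBr symZr zx1 mulr1 subrr mulr0.
  rewrite linearZr_LR /= linearBr linearZr_LR /= alt scaler0 subr0 ek.
  by rewrite scalerA mulVf // scale1r.
(* Subtracting multiples of the isotropic central vector [z] clears [(x, y)]
   and [(x, x)] without changing the bracket. *)
pose y2 := y1 - sp x1 y1 *: z; pose x2 := x1 - (sp x1 x1 / 2) *: z.
have x2y2 : br x2 y2 = z.
  rewrite linearBl !linearBr !linearZl_LR !linearZr_LR /= !cz !cz' !scaler0.
  by rewrite !subr0.
have bas : basis_of fullv [:: x2; y2; z].
  by apply: (noncommuting_central_basis dg lie cz z0); rewrite x2y2.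
have x1z : sp x1 z = 1 by rewrite symC.
have y1z : sp y1 z = 0 by rewrite symC.
have spE := (symBl, symBr, symZl, symZr, szz, x1z, y1z, zx1, zy1).
have x2x2 : sp x2 x2 = 0 by rewrite !spE; field; rewrite two_neq0.
have x2z : sp x2 z = 1 by rewrite !spE; ring.
have y2z : sp y2 z = 0 by rewrite !spE; ring.
have x2y2s : sp x2 y2 = 0 by rewrite !spE; ring.
exists x2, y2, z; do ![split] => //.
have [f [h [l [dec _ _ _]]]] := basis3_coord bas.
(* If [(y2, y2) = 0], then [y2] is orthogonal to the whole basis, hence zero, and so is [z =
   [x2, y2]]. *)
apply: contraNneq z0 => y2y2.
suff y20 : y2 = 0 by rewrite -x2y2 y20 linear0r.
apply: (nondegenerate_inj nd) => w; rewrite sym0l (dec w) !symDr !symZr.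
by rewrite y2y2 y2z symC x2y2s !mulr0 !addr0.
Qed.

(** * Realization on every Heisenberg algebra *)

(** When [f], [h], [k] are the coordinates in a standard basis, this is the form of table 1) with
    [(y, y) = c]. Abstract functionals suffice to equip it with the symmetric form structure. *)
Definition heisenberg_form (F : fieldType) (g : vectType F) (c : F)
    (f h k : {scalar g}) (u v : g) : F :=
  f u * k v + k u * f v + c * (h u * h v).

Section HeisenbergForm.
Context (F : fieldType) (g : vectType F) (c : F) (f h k : {scalar g}).
Local Notation form := (heisenberg_form c f h k).

Fact heisenberg_form_subl u : zmod_morphism (form ^~ u).
Proof. by move=> v w; rewrite /heisenberg_form !linearB /=; ring. Qed.

Fact heisenberg_form_subr u : zmod_morphism (form u).
Proof. by move=> v w; rewrite /heisenberg_form !linearB /=; ring. Qed.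

Fact heisenberg_form_scalel u : scalable_for *%R (form ^~ u).
Proof. by move=> b v; rewrite /heisenberg_form !linearZ /=; ring. Qed.

Fact heisenberg_form_scaler u : scalable_for (idfun \; *%R) (form u).
Proof. by move=> b v; rewrite /heisenberg_form !linearZ /=; ring. Qed.

Fact heisenberg_form_sym u v : form u v = (-1) ^+ false * idfun (form v u).
Proof. by rewrite /heisenberg_form /=; ring. Qed.

HB.instance Definition _ := isBilinear.Build F g g F *%R (idfun \; *%R) form
  heisenberg_form_subl heisenberg_form_subr
  heisenberg_form_scalel heisenberg_form_scaler.
HB.instance Definition _ :=
  isHermitianSesquilinear.Build F g false idfun form heisenberg_form_sym.

End HeisenbergForm.

Lemma heisenberg_realization (F : fieldType) (g : vectType F)
    (br : {bilinear g -> g -> g}) (x y z : g) (c : F) :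
  lie_bracket br -> standard_basis br x y z -> c != 0 ->
  exists (sp : {symmetric g}) (mul : g -> g -> g),
    [/\ pseudo_riemannian_lie br sp mul, sp y y = c,
        scalar_product_table sp x y z & product_table sp mul x y z].
Proof.
move=> lie [bas xy xz yz] c0; have [alt _] := lie.
have [f [h [k [dec [fx hx kx] [fy hy ky] [fz hz kz]]]]] := basis3_coord bas.
have yx : br y x = - z by rewrite (lie_anti _ _ lie) xy.
have zx : br z x = 0 by rewrite (lie_anti _ _ lie) xz oppr0.
have zy : br z y = 0 by rewrite (lie_anti _ _ lie) yz oppr0.
have brE u v : br u v = (f u * h v - h u * f v) *: z.
  rewrite {1}(dec u) {1}(dec v) !linearDl !linearDr !linearZl_LR !linearZr_LR /=.
  rewrite !alt xy xz yz yx zx zy !scaler0 !addr0 !add0r !scalerN !scalerA.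
  by rewrite scalerBl addrC.
pose sp : {symmetric g} := heisenberg_form c f h k.
(* Bilinear extension of [xy = z] and [xx = - c^-1 y]. *)
pose mul u v := (f u * h v) *: z - (c^-1 * (f u * f v)) *: y.
have spE u v : sp u v = f u * k v + k u * f v + c * (h u * h v) by [].
have cE := (fx, hx, kx, fy, hy, ky, fz, hz, kz).
have fm u v : f (mul u v) = 0 by rewrite linearB !linearZ /= !cE; ring.
have hm u v : h (mul u v) = - (c^-1 * (f u * f v)).
  by rewrite linearB !linearZ /= !cE; ring.
have km u v : k (mul u v) = f u * h v by rewrite linearB !linearZ /= !cE; ring.
have syy : sp y y = c by rewrite spE !cE; ring.
exists sp, mul; split=> //.
- split=> //.
  (* Pairing [u] with [z], [y] and [x] reads off [f u], [c * h u] and [k u]. *)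
  + apply/eqP/vspaceP => u; rewrite memv0; apply/mem_orthovP/eqP => [o|-> v _].
      have := o x (memvf _); have := o y (memvf _); have := o z (memvf _).
      rewrite !spE !cE !mulr0 !mulr1 !addr0 !add0r => f0 /eqP.
      rewrite mulf_eq0 (negPf c0) /= => /eqP h0 k0.
      by rewrite (dec u) f0 h0 k0 !scale0r !addr0.
    by rewrite sym0l.
  + move=> u v w; by rewrite !brE !symZl !spE !cE fm hm km; field.
  (* Since [f] vanishes on products, the two brackets are opposite multiples of [z], with
     coefficients [c^-1 f(u) f(v) f(w)] up to sign. *)
  + move=> u v w; rewrite !brE !fm !hm -scalerDl.
    by rewrite (_ : _ + _ = 0) ?scale0r //; ring.
- by do ![split]; rewrite ?syy // spE !cE; ring.
- by do ![split]; rewrite /mul !cE ?syy !(mulr0, mul0r, mulr1) ?scale0r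
    ?scale1r ?subr0 ?sub0r ?oppr0 ?scaleNr.
Qed.

Theorem proposition5p2 :
  (forall (F : fieldType), 2%N \notin [pchar F] ->
    (forall (g : vectType F) (br : {bilinear g -> g -> g})
        (sp : {symmetric g}) (mul : g -> g -> g),
      \dim {:g} = 3%N -> pseudo_riemannian_lie br sp mul ->
      ~ abelian_lie br -> nontrivial_center mul ->
      heisenberg br /\
      exists x y z : g,
        [/\ standard_basis br x y z,
            scalar_product_table sp x y z &
            product_table sp mul x y z]) /\
    (forall (g : vectType F) (br : {bilinear g -> g -> g}) (x y z : g) (c : F),
      lie_bracket br -> standard_basis br x y z -> c != 0 ->
      exists (sp : {symmetric g}) (mul : g -> g -> g),
        [/\ pseudo_riemannian_lie br sp mul,
            sp y y = c,
            scalar_product_table sp x y z &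
            product_table sp mul x y z])) /\
  (forall (R : realFieldType) (g : vectType R) (br : {bilinear g -> g -> g})
      (sp : {symmetric g}) (mul : g -> g -> g),
    \dim {:g} = 3%N -> ~ abelian_lie br -> nontrivial_center mul ->
    ~ riemann_lie br sp mul).
Proof.
split.
  move=> F F2; split; last by move=> *; apply: heisenberg_realization.
  move=> g br sp mul dg prl nab nc.
  have [x [y [z [sb st]]]] := central_standard_basis F2 dg prl nab nc.
  split; first by exists x, y, z.
  by exists x, y, z; split=> //; apply: product_table_of_koszul prl _ _.
move=> R g br sp mul dg nab nc [prl pos].
have R2 : 2%N \notin [pchar R] by rewrite Num.Theory.pchar_num.
(* The vector [z] is isotropic, yet nonzero because [(x, z) = 1]; this contradicts positivity. *)
have [x [y [z [_ [sxz _ [_ _ _ szz]]]]]] :=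
  central_standard_basis R2 dg prl nab nc.
have z0 : z != 0.
  by apply/eqP => z0; move: sxz; rewrite z0 sym0r => /eqP; rewrite eq_sym oner_eq0.
by have := pos z z0; rewrite szz Order.POrderTheory.ltxx.
Qed.
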